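(* Let $X=(X_t)_{t\ge 0}$ be a real-valued stochastic process with càdlàg paths, adapted to a right-continuous filtration $F=(\mathcal F_t)_{t\ge0}$. There exist families of finite deterministic constants $(K_T)_{T\ge 0}$ and $(L_T)_{T\ge 0}$ such that for every $c>0$ there exists a real-valued process $X^c=(X^c_t)_{t\ge 0}$ satisfying all of the following conditions: (1) $X^c$ has locally finite total variation (i.e. each path has finite total variation on $[0,T]$ for every $T\geq 0$); (2) $X^c$ has càdlàg paths; (3) for every $T\ge 0$ and every $t\in[0,T]$, $|X_t-X^c_t|\le K_T\,c$; (4) for every $T\ge 0$ and every $t\in[0,T]$, $|\Delta X^c_t|\le L_T\,|\Delta X_t|$; (5) $X^c$ is adapted to the filtration $F$.
   Context: For a càdlàg path $x$, $\Delta x_t=x_t-x_{t-}$ for $t>0$, and $\Delta x_0=0$. The total variation of $x$ on $[0,T]$ is $\sup_n\sup_{0\le t_0<t_1<\dots<t_n\le T}\sum_{i=1}^n|x_{t_i}-x_{t_{i-1}}|$. No probability measure is involved: the conditions hold for every path. *)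

(* Defs.v *)
From HB Require Import structures.
From mathcomp Require Import all_boot all_order all_algebra.
From mathcomp Require Import all_classical all_reals all_analysis.

Set Implicit Arguments.
Unset Strict Implicit.
Unset Printing Implicit Defensive.

Import Order.TTheory GRing.Theory Num.Theory.
Import numFieldNormedType.Exports.

Local Open Scope classical_set_scope.
Local Open Scope ring_scope.

(* Time ranges over [0, +oo[. Paths, processes and filtrations are functions on
   the whole of R; their values at negative times are irrelevant to every
   definition below. *)

(* [cvg] in R means convergence to a finite limit. *)
Definition cadlag (R : realType) (x : R -> R) : Prop :=
  (forall t : R, 0 <= t -> x s @[s --> t^'+] --> x t) /\
  (forall t : R, 0 < t -> cvg (x s @[s --> t^'-])).

Definition jump (R : realType) (x : R -> R) (t : R) : R :=
  if 0 < t then x t - lim (x s @[s --> t^'-]) else 0.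

(* The supremum defining [total_variation 0 T x] runs over the partitions with
   end points 0 and T; adding 0 and T to a partition t_0 < ... < t_n of points
   of [0, T] can only increase its sum, so this is the supremum over all such
   partitions. *)
Definition locally_finite_variation (R : realType) (x : R -> R) : Prop :=
  forall T : R, 0 <= T -> (total_variation 0 T x < +oo)%E.

Definition filtration (R : realType) (d : measure_display)
    (Omega : measurableType d) (F : R -> set (set Omega)) : Prop :=
  [/\ forall t, 0 <= t -> sigma_algebra setT (F t),
      forall t, 0 <= t -> F t `<=` measurable
    & forall s t, 0 <= s -> s <= t -> F s `<=` F t].

Definition right_continuous_filtration (R : realType) (d : measure_display)
    (Omega : measurableType d) (F : R -> set (set Omega)) : Prop :=
  filtration F /\
  forall t, 0 <= t -> F t = \bigcap_(s in [set s | t < s]) F s.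

(* [g_sigma_algebraType (F t)] is Omega with the sigma-algebra generated by
   F t, which is F t itself when F is a filtration and 0 <= t. *)
Definition adapted (R : realType) (d : measure_display)
    (Omega : measurableType d) (F : R -> set (set Omega))
    (X : R -> Omega -> R) : Prop :=
  forall t, 0 <= t ->
    measurable_fun setT (X t : g_sigma_algebraType (F t) -> R).

(* Main.v *)
Require Import Defs.
From HB Require Import structures.
From mathcomp Require Import all_boot all_order all_algebra.
From mathcomp Require Import all_classical all_reals all_analysis.
From mathcomp Require Import lra.

Import Order.TTheory GRing.Theory Num.Theory.
Import numFieldNormedType.Exports.

Local Open Scope classical_set_scope.
Local Open Scope ring_scope.

(** X^c is obtained from X path by path with the play (hysteresis) operator of
    radius c: a point that keeps within distance c of X and moves only when X
    pushes it.  The recursive description of that operator is replaced by the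
    closed formula
      play c x t = sup over s in [0, t] of
                     min (x s - c, inf over u in [s, t] of (x u + c)),
    which is the play started at x 0 - c.  The constants K_T = L_T = 1 work.

    - Taking s = t bounds the supremum below by x t - c, and u = t bounds it
      above by x t + c, so |x - play c x| <= c ([play_dist]).
    - Between two times s <= t the play can only be pushed up by high values of
      x and down by low values: if m <= x <= M on [s, t], then
        min (play s, m + c) <= play t <= max (play s, M - c)
      ([play_ge_min], [play_le_max]).  Everything else about paths follows from
      these two bounds.
    - Combined with |x - play c x| <= c they show that an increment of the play
      is at most the oscillation of x ([play_osc]); hence the play is cadlag
      if x is, and its jumps are no larger ([cadlag_play], [jump_play]).
    - If x stays within c of a level l on [a, b[, then m + c and M - c may both
      be replaced by l: the play moves monotonically towards l, so it has
      bounded variation on [a, b] ([play_bounded_variation_itvco]).  A cadlag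
      path has this property near every time, on the left and on the right, and
      a real induction on [0, T] concludes ([locally_finite_variation_play]).
    - By right-continuity the supremum and the infimum can be restricted to
      rational times and t, so play c X t is measurable with respect to the
      values of X at times in [0, t] ([lt_playP], [measurable_play]). *)

(** * The play operator *)

Section play_operator.
Context {R : realType}.
Implicit Types (c m M a b e l s t u T : R) (x f : R -> R).

(** The reals below min (x s - c, inf over [s, t] of x + c) for some s.  Asking
    for lower bounds avoids the inner infimum, hence any a priori bound on x. *)
Definition play_floor c x t : set R :=
  [set a | exists s, [/\ 0 <= s <= t, a <= x s - c
                       & forall u, s <= u <= t -> a <= x u + c]].

Definition play c x t : R := sup (play_floor c x t).

Lemma play_floor_self c x t : 0 <= c -> 0 <= t -> play_floor c x t (x t - c).
Proof.
move=> c0 t0; exists t; split; [by rewrite t0 lexx|by []|move=> u].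
by rewrite -eq_le => /eqP <-; lra.
Qed.

Lemma play_floor_ubound c x t : ubound (play_floor c x t) (x t + c).
Proof. by move=> a [s [/andP[_ st] _]]; apply; rewrite st lexx. Qed.

Lemma play_floor_le c x t a : play_floor c x t a -> a <= play c x t.
Proof. by apply: ub_le_sup; exists (x t + c); exact: play_floor_ubound. Qed.

Lemma play_le c x t M : 0 <= c -> 0 <= t ->
  (forall a, play_floor c x t a -> a <= M) -> play c x t <= M.
Proof.
by move=> c0 t0 H; apply: ge_sup => //; exists (x t - c); exact: play_floor_self.
Qed.

Lemma lt_play c x t a : 0 <= c -> 0 <= t -> a < play c x t ->
  exists2 b, play_floor c x t b & a < b.
Proof.
by move=> c0 t0; apply: sup_gt; exists (x t - c); exact: play_floor_self.
Qed.

Lemma play_dist c x t : 0 <= c -> 0 <= t -> `|x t - play c x t| <= c.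
Proof.
move=> c0 t0; rewrite ler_distl.
have := play_floor_le _ _ _ _ (play_floor_self _ x _ c0 t0).
have := play_le _ _ _ _ c0 t0 (play_floor_ubound c x t).
by move=> ? ?; apply/andP; split; lra.
Qed.

(** A floor a at time t has a witness r.  If r <= s the same witness serves at
    time s; otherwise a <= x r - c with r in [s, t]. *)
Lemma play_le_max c x s t M : 0 <= c -> 0 <= s -> s <= t ->
  (forall u, s <= u <= t -> x u <= M) ->
  play c x t <= Num.max (play c x s) (M - c).
Proof.
move=> c0 s0 st xM; apply: play_le => //; first exact: le_trans st.
move=> a [r [/andP[r0 rt] ar ax]]; rewrite le_max; apply/orP.
have [rs|/ltW sr] := leP r s; [left|right].
- apply: play_floor_le; exists r; split=> [|//|u /andP[ru us]]; first by rewrite r0.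
  by apply: ax; rewrite ru (le_trans us).
- by apply: le_trans ar _; rewrite lerB// xM// sr.
Qed.

(** A floor at time s remains a floor at time t, with the same witness, once it
    is lowered to m + c. *)
Lemma play_ge_min c x s t m : 0 <= c -> 0 <= s -> s <= t ->
  (forall u, s <= u <= t -> m <= x u) ->
  Num.min (play c x s) (m + c) <= play c x t.
Proof.
move=> c0 s0 st mx; rewrite leNgt lt_min; apply/negP => /andP[yty ytm].
have [a [r [/andP[r0 rs] ar ax]] ya] := lt_play _ _ _ _ c0 s0 yty.
suff : Num.min a (m + c) <= play c x t by rewrite leNgt lt_min ya ytm.
apply: play_floor_le; exists r; split.
- by rewrite r0 (le_trans rs).
- by rewrite ge_min ar.
- move=> u /andP[ru ut]; rewrite ge_min; apply/orP.
  have [us|/ltW su] := leP u s; [left|right]; first by apply: ax; rewrite ru.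
  by rewrite lerD2r mx// su.
Qed.

(** An upward increment is caused by the term M - c, and M - c <= play s + (M - m)
    because play s >= x s - c >= m - c; downward increments are symmetric. *)
Lemma play_osc c x s t m M : 0 <= c -> 0 <= s -> s <= t ->
  (forall u, s <= u <= t -> m <= x u <= M) ->
  `|play c x t - play c x s| <= M - m.
Proof.
move=> c0 s0 st xmM.
have xM u : s <= u <= t -> x u <= M by move/xmM/andP => [].
have mx u : s <= u <= t -> m <= x u by move/xmM/andP => [].
have sst : s <= s <= t by rewrite lexx.
have := play_le_max _ _ _ _ _ c0 s0 st xM.
have := play_ge_min _ _ _ _ _ c0 s0 st mx.
have := play_dist _ x _ c0 s0.
have := xM _ sst; have := mx _ sst.
rewrite !ler_distl le_max ge_min => ? ? /andP[? ?] /orP[?|?] /orP[?|?];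
  by apply/andP; split; lra.
Qed.

(** * Regularity and jumps of the play *)

Lemma cadlag_near_right x t e : cadlag x -> 0 <= t -> 0 < e ->
  exists2 b, t < b & forall u, t <= u < b -> `|x u - x t| <= e.
Proof.
move=> [xr _] t0 e0.
have /cvgrPdist_le /(_ e e0) [d /= d0 xd] := xr t t0.
exists (t + d); first by rewrite ltrDl.
move=> u /andP[]; rewrite le_eqVlt => /predU1P[<- _|tu utd].
  by rewrite subrr normr0 ltW.
rewrite distrC; apply: xd => //=.
by rewrite distrC gtr0_norm; lra.
Qed.

Lemma cadlag_near_left x t e : cadlag x -> 0 < t -> 0 < e ->
  exists2 a, 0 <= a < t &
    forall u, a <= u < t -> `|x u - lim (x s @[s --> t^'-])| <= e.
Proof.
move=> [_ xl] t0 e0.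
have /cvgrPdist_le /(_ e e0) [d /= d0 xd] := xl t t0.
exists (Num.max 0 (t - d / 2)).
  by rewrite le_max lexx gt_max t0/=; lra.
move=> u; rewrite ge_max => /andP[/andP[u0 tdu] ut].
rewrite distrC; apply: xd => //=.
by rewrite gtr0_norm; lra.
Qed.

Lemma cadlag_play c x : 0 <= c -> cadlag x -> cadlag (play c x).
Proof.
move=> c0 xc; split=> t t0.
- apply/cvgrPdist_le => e e0.
  have e20 : 0 < e / 2 by lra.
  have [b tb xb] := cadlag_near_right _ _ _ xc t0 e20.
  near=> s; have ts : t < s by near: s; exact: nbhs_right_gt.
  have sb : s < b by near: s; exact: nbhs_right_lt.
  rewrite distrC (_ : e = (x t + e / 2) - (x t - e / 2)); last by lra.
  apply: play_osc (ltW ts) _ => // u /andP[tu us]; rewrite -ler_distl; apply: xb.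
  by rewrite tu (le_lt_trans us).
- apply/cauchy_cvgP/cauchy_exP => e e0.
  have e30 : 0 < e / 3 by lra.
  have [a /andP[a0 at_] xa] := cadlag_near_left _ _ _ xc t0 e30.
  exists (play c x a).
  change (\forall s \near t^'-, ball (play c x a) e (play c x s)).
  near=> s; rewrite /ball/= distrC.
  have as_ : a < s by near: s; exact: nbhs_left_gt.
  have st : s < t by near: s; exact: nbhs_left_lt.
  set l := lim _ in xa.
  apply: (@le_lt_trans _ _ ((l + e / 3) - (l - e / 3))); last by lra.
  apply: play_osc (ltW as_) _ => // u /andP[au us]; rewrite -ler_distl; apply: xa.
  by rewrite au (le_lt_trans us).
Unshelve. all: by end_near. Qed.

(** Just before t, x is within e / 2 of its left limit l, so its oscillation on
    [s, t] is at most |x t - l| + e; then s tends to t and e to 0. *)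
Lemma jump_play c x t : 0 <= c -> cadlag x ->
  `|jump (play c x) t| <= `|jump x t|.
Proof.
move=> c0 xc; rewrite /jump; case: ifP => // t0.
have yl : cvg (play c x s @[s --> t^'-]) by exact: (cadlag_play c x c0 xc).2.
apply/ler_addgt0Pr => e e0; have e20 : 0 < e / 2 by lra.
have [a /andP[a0 at_] xa] := cadlag_near_left _ _ _ xc t0 e20.
set l := lim (x s @[s --> t^'-]) in xa *.
have step : \forall s \near t^'-,
    play c x t - (`|x t - l| + e) <= play c x s <= play c x t + (`|x t - l| + e).
  near=> s.
  have as_ : a < s by near: s; exact: nbhs_left_gt.
  have st : s < t by near: s; exact: nbhs_left_lt.
  rewrite -ler_distl distrC.
  apply: (@le_trans _ _ ((Num.max l (x t) + e / 2) - (Num.min l (x t) - e / 2))).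
    have s0 : 0 <= s by lra.
    apply: play_osc (ltW st) _ => // u /andP[su]; rewrite le_eqVlt => /predU1P[->|ut].
      by apply/andP; split; case: (leP l (x t)) => ?; lra.
    have /xa : a <= u < t by rewrite ut andbT; lra.
    rewrite ler_distl => /andP[? ?].
    by apply/andP; split; case: (leP l (x t)) => ?; lra.
  have := ler_norm (x t - l); have := ler_norm (l - x t); rewrite distrC.
  by case: (leP l (x t)) => ? ? ?; lra.
rewrite ler_distlC; apply/andP; split.
- by apply: limr_ge => //; apply: filterS step => s /andP[].
- by apply: limr_le => //; apply: filterS step => s /andP[].
Unshelve. all: by end_near. Qed.

(** * Finite variation of the play *)

Lemma bounded_variation_cat s t u f : s <= t -> t <= u ->
  bounded_variation s t f -> bounded_variation t u f -> bounded_variation s u f.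
Proof.
move=> st tu /(bounded_variationP f st) fst /(bounded_variationP f tu) ftu.
apply/bounded_variationP; first exact: le_trans tu.
by rewrite (total_variationD f st tu) fin_numD fst.
Qed.

(** The value at b is arbitrary, to allow for a jump there.  Adding a large step
    h at b makes f nondecreasing on the whole of [a, b], so f is the difference
    of the nondecreasing functions f + h and h. *)
Lemma bounded_variation_monotone_itvco a b M f : a < b ->
  {in `[a, b[ &, {homo f : s t / s <= t}} ->
  (forall t, a <= t < b -> f t <= M) -> bounded_variation a b f.
Proof.
move=> ab f_nd fM.
pose h t := if b <= t then `|M - f b| else 0.
rewrite (_ : f = (f \+ h) \+ (\- h)); last by apply/funext => t /=; rewrite addrK.
apply: bounded_variationD => //; last first.
  apply/bounded_variationN/nondecreasing_bounded_variation => s t _ _ st.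
  rewrite /h; case: (leP b s) => [bs|_]; first by rewrite (le_trans bs st).
  by case: ifP.
apply: nondecreasing_bounded_variation => s t.
rewrite !in_itv/= => /andP[as_ sb] /andP[at_ tb] st; rewrite /h.
have [bs|sb'] := leP b s.
  have -> : s = t by apply/le_anti; rewrite st (le_trans tb).
  by rewrite (le_trans bs st).
have [bt|tb'] := leP b t; last by rewrite !addr0 f_nd// in_itv/= ?as_ ?at_.
have -> : t = b by apply/le_anti; rewrite tb.
have := ler_norm (M - f b); have := fM s; rewrite as_ sb' => /(_ isT); lra.
Qed.

(** With x in [l - c, l + c] the two one-sided bounds become
    min (play s, l) <= play t <= max (play s, l).  So the play cannot cross l,
    and it is nondecreasing when it starts below l, nonincreasing above. *)
Lemma play_bounded_variation_itvco c x a b l : 0 <= c -> 0 <= a -> a < b ->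
  (forall u, a <= u < b -> `|x u - l| <= c) ->
  bounded_variation a b (play c x).
Proof.
move=> c0 a0 ab xl.
have up s t : a <= s -> s <= t -> t < b ->
    play c x t <= Num.max (play c x s) l.
  move=> as_ st tb; rewrite -[l](addrK c); apply: play_le_max => //; first by lra.
  move=> u /andP[su ut]; have /xl : a <= u < b by apply/andP; split; lra.
  by rewrite ler_distl => /andP[].
have down s t : a <= s -> s <= t -> t < b ->
    Num.min (play c x s) l <= play c x t.
  move=> as_ st tb; rewrite -[l](subrK c); apply: play_ge_min => //; first by lra.
  move=> u /andP[su ut]; have /xl : a <= u < b by apply/andP; split; lra.
  by rewrite ler_distl => /andP[].
have [yl|/ltW ly] := leP (play c x a) l.
- have yb t : a <= t < b -> play c x t <= l.
    by move=> /andP[at_ tb]; have := up _ _ (lexx a) at_ tb; rewrite (max_r yl).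
  apply: (bounded_variation_monotone_itvco _ _ l) => // s t.
  rewrite !in_itv/= => /andP[as_ sb] /andP[at_ tb] st.
  by have := down _ _ as_ st tb; rewrite min_l// yb// as_.
- have yb t : a <= t < b -> l <= play c x t.
    by move=> /andP[at_ tb]; have := down _ _ (lexx a) at_ tb; rewrite (min_r ly).
  rewrite -[play c x]opprK.
  apply/bounded_variationN/(bounded_variation_monotone_itvco _ _ (- l)) => //.
    move=> s t; rewrite !in_itv/= => /andP[as_ sb] /andP[at_ tb] st.
    rewrite lerN2.
    by have := up _ _ as_ st tb; rewrite max_l// yb// as_.
  by move=> t /yb ?; rewrite lerN2.
Qed.

(** Real induction: the supremum r of the times up to which f has bounded
    variation is attained by the hypothesis on the left of r, and equals T by
    the hypothesis on the right of r. *)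
Lemma locally_finite_variation_local f :
  (forall t, 0 <= t -> exists2 b, t < b & bounded_variation t b f) ->
  (forall t, 0 < t -> exists2 a, a < t &
    forall s, 0 <= s -> a <= s < t -> bounded_variation s t f) ->
  locally_finite_variation f.
Proof.
move=> fr fl T T0.
suff /(bounded_variationP f T0) : bounded_variation 0 T f.
  by rewrite fin_numElt => /andP[].
pose S := [set t | 0 <= t <= T /\ bounded_variation 0 t f].
have S0 : S 0 by split; [rewrite lexx|exact: bounded_variationxx].
have ST : ubound S T by move=> t [/andP[]].
have Sub : has_ubound S by exists T.
pose r := sup S.
have r0 : 0 <= r by exact: ub_le_sup.
have rT : r <= T by apply: ge_sup => //; exists 0.
have fr0 : bounded_variation 0 r f.
  move: r0; rewrite le_eqVlt => /predU1P[<-|r0]; first exact: bounded_variationxx.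
  have [a ar fa] := fl r r0.
  have [|s [/andP[s0 sT] fs] as_] := sup_gt _ ar; first by exists 0.
  have sr : s <= r by apply: ub_le_sup => //; split=> //; rewrite s0.
  move: sr; rewrite le_eqVlt => /predU1P[<-//|sr].
  apply: (bounded_variation_cat _ s) => //; first exact: ltW.
  by apply: fa => //; rewrite sr ltW.
move: rT; rewrite le_eqVlt => /predU1P[<-//|rT].
have [b rb fb] := fr r r0.
pose t := Num.min b T.
have rt : r < t by rewrite lt_min rb.
suff /ub_le_sup : S t by move=> /(_ Sub); rewrite leNgt rt.
split; first by rewrite ge_min lexx orbT andbT (le_trans r0)// ltW.
apply: (bounded_variation_cat _ r) => //; first exact: ltW.
by apply: (bounded_variationl _ _ fb); [exact: ltW|rewrite ge_min lexx].
Qed.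

Lemma locally_finite_variation_play c x : 0 < c -> cadlag x ->
  locally_finite_variation (play c x).
Proof.
move=> c0 xc; apply: locally_finite_variation_local => t t0.
- have [b tb xb] := cadlag_near_right _ _ _ xc t0 c0.
  by exists b => //; apply: (play_bounded_variation_itvco _ _ _ _ _ (ltW c0) t0 tb xb).
- have [a /andP[a0 at_] xa] := cadlag_near_left _ _ _ xc t0 c0.
  exists a => // s s0 /andP[as_ st].
  apply: (play_bounded_variation_itvco _ _ _ _ _ (ltW c0) s0 st) => u /andP[su ut].
  by apply: xa; rewrite ut (le_trans as_).
Qed.

(** * Measurability of the play *)

(** A countable family of times in [0, t] that is dense in [0, t] and contains t
    (the index None); rationals outside [0, t] are sent to t as well. *)
Definition sample_time t (i : option rat) : R :=
  if i is Some q then (if 0 <= (ratr q : R) <= t then ratr q else t) else t.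

Lemma sample_time_itv t i : 0 <= t -> 0 <= sample_time t i <= t.
Proof.
by move=> t0; case: i => [q|] /=; [case: ifP|]; rewrite // t0 lexx.
Qed.

Lemma sample_time_dense t s b : 0 <= s -> s < t -> s < b ->
  exists i, s < sample_time t i < b.
Proof.
move=> s0 st sb.
have : s < Num.min t b by rewrite lt_min st.
move=> /rat_in_itvoo[q]; rewrite in_itv/= lt_min => /and3P[sq qt qb].
exists (Some q) => /=; rewrite ifT ?sq ?qb//.
by apply/andP; split; lra.
Qed.

(** Above a < play c x t there is a rational floor q with some slack.  The slack
    and right-continuity move the witness s to a sample time slightly later,
    unless s = t.  Conversely, if x u + c < q at some u < t, then the same holds
    at a sample time just after u, so it is enough to test sample times. *)
Lemma lt_playP c x t a : 0 <= c -> cadlag x -> 0 <= t ->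
  a < play c x t <->
  exists q i, [/\ a < ratr q, ratr q <= x (sample_time t i) - c
    & forall j, sample_time t i <= sample_time t j ->
        ratr q <= x (sample_time t j) + c].
Proof.
move=> c0 xc t0; split.
- move=> /(lt_play _ _ _ _ c0 t0)[v [s [/andP[s0 st] vs vx]] av].
  have [q] := rat_in_itvoo av; rewrite in_itv/= => /andP[aq qv].
  exists q; move: st; rewrite le_eqVlt => /predU1P[ste|st].
    exists None; split => //=; first by rewrite -ste; lra.
    move=> j tj; apply: (le_trans (ltW qv)); apply: vx.
    by rewrite ste tj; case/andP: (sample_time_itv t j t0).
  have qv0 : 0 < v - ratr q by lra.
  have [b sb xb] := cadlag_near_right _ _ _ xc s0 qv0.
  have [i /andP[si ib]] := sample_time_dense _ _ _ s0 st sb.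
  exists i; split => //.
    have /xb : s <= sample_time t i < b by rewrite ib ltW.
    by rewrite ler_distl => /andP[? ?]; lra.
  move=> j ij; apply: (le_trans (ltW qv)); apply: vx.
  by case/andP: (sample_time_itv t j t0) => _ ->; rewrite andbT; lra.
- move=> [q [i [aq qi qj]]]; apply: (lt_le_trans aq); apply: play_floor_le.
  exists (sample_time t i); split => //; first exact: sample_time_itv.
  move=> u /andP[iu]; rewrite le_eqVlt => /predU1P[ut|ut].
    by move: iu; rewrite ut; exact: (qj None).
  rewrite leNgt; apply/negP => xuq.
  have u0 : 0 <= u.
    by apply: le_trans iu; case/andP: (sample_time_itv t i t0).
  have e0 : 0 < (ratr q - (x u + c)) / 2 by rewrite divr_gt0 ?subr_gt0.
  have [b ub xb] := cadlag_near_right _ _ _ xc u0 e0.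
  have [j /andP[uj jb]] := sample_time_dense _ _ _ u0 ut ub.
  have /xb : u <= sample_time t j < b by rewrite jb ltW.
  rewrite ler_distl => /andP[? ?].
  have : ratr q <= x (sample_time t j) + c by apply: qj; lra.
  lra.
Qed.

(** [lt_playP] writes the event a < play as a countable union, over q and i, of
    countable intersections of events about X at sample times; the intersection
    over j is handled as the complement of a union. *)
Lemma measurable_play d (Omega : measurableType d) (X : R -> Omega -> R) c t :
  0 <= c -> 0 <= t -> (forall w, cadlag (X ^~ w)) ->
  (forall s, 0 <= s <= t -> measurable_fun setT (X s)) ->
  measurable_fun setT (fun w => play c (X ^~ w) t).
Proof.
move=> c0 t0 Xc mX _.
have mge a i : measurable [set w | a <= X (sample_time t i) w].
  rewrite -[X in measurable X]setTI -preimage_itvcy.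
  by apply: mX => //; exact: sample_time_itv.
apply: (measurability _ (measurable_realfun.RGenOInfty.measurableE R)) => //.
move=> /= _ [_ [a ->] <-]; rewrite setTI preimage_itvoy.
pose A (qi : rat * option rat) := [set w |
  [/\ a < ratr qi.1, ratr qi.1 <= X (sample_time t qi.2) w - c
    & forall j, sample_time t qi.2 <= sample_time t j ->
        ratr qi.1 <= X (sample_time t j) w + c]].
rewrite [X in measurable X](_ : _ = \bigcup_qi A qi); last first.
  apply/seteqP; split => w /=.
    by move=> /(lt_playP _ _ _ _ c0 (Xc w) t0)[q [i H]]; exists (q, i).
  move=> [[q i] _ H]; apply/(lt_playP _ _ _ _ c0 (Xc w) t0).
  by exists q, i.
apply: countable_bigcupT_measurable => // -[q i].
have [aq|aq] := ltP a (ratr q); last first.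
  rewrite [X in measurable X](_ : _ = set0)//.
  by rewrite -subset0 => w [/=]; rewrite ltNge aq.
rewrite [X in measurable X](_ : _ =
   [set w | ratr q + c <= X (sample_time t i) w] `\`
   \bigcup_j (if sample_time t i <= sample_time t j then
     ~` [set w | ratr q - c <= X (sample_time t j) w] else set0)).
  apply: measurableD => //; apply: countable_bigcupT_measurable => // j.
  by case: ifP => // _; exact: measurableC.
apply/seteqP; split => w /=.
- move=> [_ wi wj]; split; first by move: wi => /=; lra.
  move=> [j _]; case: ifP => // ij /=; apply.
  by have := wj j ij => /=; lra.
- move=> [wi wj]; split => //=; first by lra.
  move=> j ij; rewrite leNgt; apply/negP => wjq; apply: wj.
  by exists j => //; rewrite ij /= => ?; lra.
Qed.

End play_operator.

Lemma adapted_sub {R : realType} {d} {Omega : measurableType d}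
    {F : R -> set (set Omega)} {X : R -> Omega -> R} (s t : R) :
  filtration F -> adapted F X -> 0 <= s -> s <= t ->
  measurable_fun setT (X s : g_sigma_algebraType (F t) -> R).
Proof.
move=> [_ _ Fmono] FX s0 st _ B mB.
have := FX s s0 measurableT B mB; exact: (sub_sigma_algebra2 (Fmono s t s0 st)).
Qed.

Theorem mainTheorem1 (R : realType) (d : measure_display)
    (Omega : measurableType d) (F : R -> set (set Omega))
    (X : R -> Omega -> R)
    (F_rc : right_continuous_filtration F)
    (X_cadlag : forall w : Omega, cadlag (fun t => X t w))
    (X_adapted : adapted F X) :
  exists K L : R -> R,
  forall c : R, 0 < c ->
  exists Xc : R -> Omega -> R,
    [/\ forall w : Omega, locally_finite_variation (fun t => Xc t w),
        forall w : Omega, cadlag (fun t => Xc t w),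
        forall (w : Omega) (T : R), 0 <= T -> forall t : R, 0 <= t <= T ->
          `|X t w - Xc t w| <= K T * c,
        forall (w : Omega) (T : R), 0 <= T -> forall t : R, 0 <= t <= T ->
          `|jump (fun s => Xc s w) t| <= L T * `|jump (fun s => X s w) t|
      & adapted F Xc].
Proof.
exists (cst 1), (cst 1) => c c0; have c0' := ltW c0.
exists (fun t w => play c (X ^~ w) t); split.
- by move=> w; exact: locally_finite_variation_play.
- by move=> w; exact: cadlag_play.
- by move=> w T _ t /andP[t0 _]; rewrite mul1r; exact: play_dist.
- by move=> w T _ t _; rewrite mul1r; exact: jump_play.
- move=> t t0.
  apply: (@measurable_play R _ (g_sigma_algebraType (F t)) X c t) => //.
  move=> s /andP[s0 st]; exact: adapted_sub F_rc.1 X_adapted s0 st.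
Qed.
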